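(* For every integer $d\ge 2$, the graph $\Gamma(d)$ is connected.
   Context: A polytope is the convex hull of a finite set of points. Let $P\subset\mathbb{R}^d$ be a $d$-dimensional polytope with vertex set $\mathcal{V}$. A point $x\in\mathbb{R}^d\setminus P$ can be inserted in $P$ if the vertex set of the convex hull of $P\cup\{x\}$ is exactly $\mathcal{V}\cup\{x\}$; the insertion move then replaces $P$ by this convex hull. A vertex $v\in\mathcal{V}$ can be deleted from $P$ if the convex hull of $\mathcal{V}\setminus\{v\}$ is still $d$-dimensional; the deletion move then replaces $P$ by this convex hull. $\Gamma(d)$ is the (infinite, undirected) graph whose vertices are all $d$-dimensional polytopes contained in $\mathbb{R}^d$ and whose edges connect two polytopes when one is obtained from the other by a single insertion move (equivalently, the other by a single deletion move). *)

(* Defs.v *)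
From Stdlib Require Export Relation_Operators.
From mathcomp Require Export all_boot all_order all_algebra.
From mathcomp Require Export mathcomp_extra boolp classical_sets cardinality.
From mathcomp Require Export reals convex.

Set Implicit Arguments.
Unset Strict Implicit.
Unset Printing Implicit Defensive.

Import Order.TTheory GRing.Theory Num.Theory.
Local Open Scope classical_set_scope.
Local Open Scope ring_scope.

Section Polytopes.
Variables (R : realType) (d : nat).
Local Notation E := ('rV[R]_d).
Implicit Types (A P Q : set E) (x v : E).

Definition convex_hull A : set E := smallest (@convex_set R E) A.

Definition polytope P : Prop := exists2 A, finite_set A & P = convex_hull A.

Definition affine_set A : Prop :=
  forall x y (t : R), A x -> A y -> A (t *: x + (1 - t) *: y).

Definition affine_hull A : set E := smallest affine_set A.

(* The dimension of A is that of its affine hull, i.e., of the direction U of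
   this hull. The empty set has no dimension in this sense. *)
Definition has_dim A (k : nat) : Prop :=
  exists x (U : {vspace E}),
    affine_hull A = [set x + u | u in [set` U]] /\ \dim U = k.

(* The vertices of a polytope are its extreme points. *)
Definition vertices P : set E :=
  [set v | P v /\ forall y z (t : R), P y -> P z -> 0 < t -> t < 1 ->
                    v = t *: y + (1 - t) *: z -> y = v /\ z = v].

Definition can_insert P x : Prop :=
  ~ P x /\ vertices (convex_hull (P `|` [set x])) = vertices P `|` [set x].

Definition insertion_move P Q : Prop :=
  exists2 x, can_insert P x & Q = convex_hull (P `|` [set x]).

(* The vertex type of Gamma(d). *)
Definition full_polytope : Type := {P : set E | polytope P /\ has_dim P d}.

(* The edges of Gamma(d). Undoing an insertion move is a deletion move and
   conversely, so no separate clause for deletions is needed. *)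
Definition Gamma (P Q : full_polytope) : Prop :=
  insertion_move (sval P) (sval Q) \/ insertion_move (sval Q) (sval P).

End Polytopes.

(* For an undirected graph, given by a symmetric adjacency relation. *)
Definition graph_connected (V : Type) (adj : V -> V -> Prop) : Prop :=
  inhabited V /\ forall x y : V, clos_refl_trans V adj x y.

(* Main.v *)
Require Import Defs.
From mathcomp Require Import interval_inference ring lra.

Set Implicit Arguments.
Unset Strict Implicit.
Unset Printing Implicit Defensive.

Import Order.TTheory GRing.Theory Num.Theory.
Local Open Scope classical_set_scope.
Local Open Scope ring_scope.

(** Every polytope is the hull of its vertices, and a finite set [V] is the
    vertex set of its hull as soon as it is in convex position, i.e., no point
    of [V] lies in the hull of the others ([vertices_convex_position]). A subset
    of a set in convex position is again in convex position, so that deleting a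
    point [v] of [V] is an edge of the graph whenever both [V] and [V `\ v]
    span the space affinely. As a consequence, the hull of [V] is connected to
    the hull of each spanning subset of [V] ([joined_sub]), in particular to a
    simplex, since [V] contains an affine basis ([spanning_frame]).

    It remains to connect any two simplices. Let [x] have barycentric
    coordinates [l] with respect to the vertices [b j] of a simplex. If [l] has
    two positive entries and a negative one, then [x] and all the [b j] together
    are in convex position ([convex_position_frameU1]): inserting [x] and then
    deleting some [b i] with [l i != 0] replaces [b i] by [x]
    ([joined_insert_delete]). When the signs of the coordinates of a point [y]
    with [l i != 0] do not allow this, [y] still replaces [b i], through
    intermediate simplices ([joined_exchange]):
    - if [l i > 0], the point [x = l i * b i + M * b p + (1 - l i - M) * b q]
      can for [M] large enough replace both [b i] in the original simplex and
      [y] in the target one, because its coordinates in the latter are [1],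
      [M - l p] and [1 - l i - M - l q] at the positions [i], [p] and [q];
    - if [l i < 0], replacing first [b i] by [b p + b q - b i] moves it to the
      side of [y] of the opposite facet and reduces to the previous case.
    This takes three distinct vertices, whence the hypothesis on the dimension.
    Finally, by Steinitz exchange, replacements of a single vertex lead from any
    simplex to any other ([joined_frames]). *)

(** * Convex hulls and convex position *)

Section ConvexHull.
Variables (R : realType) (d : nat).
Local Notation E := ('rV[R]_d).
Implicit Types (A C V W : set E) (v w x y : E).

Lemma convex_setP A : convex_set A <->
  forall x y (t : R), A x -> A y -> 0 <= t -> t <= 1 ->
    A (t *: x + (1 - t) *: y).
Proof.
split=> [cA x y t Ax Ay t0 t1|cA x y t /set_mem Ax /set_mem Ay].
  exact: (set_mem (cA x y (Itv01 t0 t1) (mem_set Ax) (mem_set Ay))).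
exact/mem_set/cA.
Qed.

Lemma convex_convex_hull A : convex_set (convex_hull A).
Proof.
apply/convex_setP => x y t Ax Ay t0 t1 C [cC AC].
by move/convex_setP: (cC); apply=> //; [apply: Ax|apply: Ay].
Qed.

Lemma sub_convex_hull A : A `<=` convex_hull A.
Proof. exact: sub_gen_smallest. Qed.

Lemma convex_hull_min A C : convex_set C -> A `<=` C -> convex_hull A `<=` C.
Proof. exact: smallest_sub. Qed.

Lemma convex_hullS A C : A `<=` C -> convex_hull A `<=` convex_hull C.
Proof.
move=> AC; apply: convex_hull_min; first exact: convex_convex_hull.
exact: subset_trans AC (@sub_convex_hull C).
Qed.

Lemma convex_hullU A C :
  convex_hull (convex_hull A `|` C) = convex_hull (A `|` C).
Proof.
apply/seteqP; split; last first.
  by apply: convex_hullS; apply: setSU; exact: sub_convex_hull.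
apply: convex_hull_min; first exact: convex_convex_hull.
rewrite subUset; split; first by apply: convex_hullS; exact: subsetUl.
exact: subset_trans (@subsetUr _ A C) (@sub_convex_hull _).
Qed.

(** Allowing a point of weight [0] to be outside of [C] makes the mixture of two
    segments issued from a common point a single case below. *)
Lemma convex_set_barycenter C y z (a b : R) : convex_set C ->
  0 <= a -> 0 <= b -> 0 < a + b -> a = 0 \/ C y -> b = 0 \/ C z ->
  C ((a + b)^-1 *: (a *: y + b *: z)).
Proof.
move=> /convex_setP cC a0 b0 ab_gt0 [a_0|Cy].
  case=> [b_0|Cz]; first by rewrite a_0 b_0 addr0 ltxx in ab_gt0.
  rewrite a_0 add0r in ab_gt0 *.
  by rewrite scale0r add0r scalerA mulVf ?scale1r// gt_eqF.
case=> [b_0|Cz].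
  rewrite b_0 addr0 in ab_gt0 *.
  by rewrite scale0r addr0 scalerA mulVf ?scale1r// gt_eqF.
have -> : (a + b)^-1 *: (a *: y + b *: z) =
    (a / (a + b)) *: y + (1 - a / (a + b)) *: z.
  by apply/rowP => k; rewrite !mxE; field; rewrite gt_eqF.
apply: cC => //; first by rewrite divr_ge0// ltW.
by rewrite ler_pdivrMr// mul1r lerDl.
Qed.

(** The union of the segments from [v] to [C] is the hull of [C] and [v]; the
    alternative [r = 0] keeps [v] itself when [C] is empty. *)
Lemma convex_cone C v : convex_set C ->
  convex_set [set x | exists r y,
    [/\ 0 <= r, r <= 1, r = 0 \/ C y & x = v + r *: (y - v)]].
Proof.
move=> cC.
apply/convex_setP => _ _ t [r [y [r0 r1 Cy ->]]] [s [z [s0 s1 Cz ->]]] t0 t1.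
have tr0 : 0 <= t * r by exact: mulr_ge0.
have ts0 : 0 <= (1 - t) * s by apply: mulr_ge0; rewrite ?subr_ge0.
have mixE : t *: (v + r *: (y - v)) + (1 - t) *: (v + s *: (z - v)) =
    v + (t * r) *: (y - v) + ((1 - t) * s) *: (z - v).
  by apply/rowP => k; rewrite !mxE; ring.
have [/eqP|q0] := eqVneq (t * r + (1 - t) * s) 0.
  rewrite paddr_eq0// => /andP[/eqP tr /eqP ts].
  exists 0, v; split; rewrite ?ler01//; first by left.
  by rewrite mixE tr ts !scale0r !addr0.
have q_gt0 : 0 < t * r + (1 - t) * s by rewrite lt_def q0 addr_ge0.
exists (t * r + (1 - t) * s), ((t * r + (1 - t) * s)^-1 *:
  ((t * r) *: y + ((1 - t) * s) *: z)); split => //.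
- exact: ltW.
- by nra.
- right; apply: convex_set_barycenter => //.
    by case: Cy => [->|]; [left; rewrite mulr0|right].
  by case: Cz => [->|]; [left; rewrite mulr0|right].
- rewrite mixE; apply/rowP => k; rewrite !mxE; field.
  exact: q0.
Qed.

Definition convex_position V := forall v, V v -> ~ convex_hull (V `\ v) v.

Lemma convex_positionS V W : W `<=` V -> convex_position V -> convex_position W.
Proof.
move=> WV cV v Wv Cv; apply: (cV v (WV _ Wv)).
by move: Cv; apply: convex_hullS; exact: setSD.
Qed.

(** A vertex [v] of the hull of [A] can be removed from this hull without
    destroying convexity; by minimality of the hull, [v] is in [A]. *)
Lemma vertices_sub A : vertices (convex_hull A) `<=` A.
Proof.
move=> v [Av extr]; apply: contrapT => nAv.
suff sub : convex_hull A `<=` convex_hull A `\ v.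
  by case: (sub v Av) => _; apply.
apply: convex_hull_min; last first.
  move=> x Ax; split; first exact: sub_convex_hull.
  by move=> xv; apply: nAv; rewrite -xv.
apply/convex_setP => x y t [Ax xv] [Ay yv] t0 t1; split.
  by move/convex_setP: (@convex_convex_hull A); apply.
move=> /= e; have [t_0|tn0] := eqVneq t 0.
  by apply: yv; rewrite /= -e t_0 scale0r add0r subr0 scale1r.
have [t_1|tn1] := eqVneq t 1.
  by apply: xv; rewrite /= -e t_1 subrr scale0r addr0 scale1r.
case: (extr x y t Ax Ay) => //; first by rewrite lt_def tn0.
by rewrite lt_def eq_sym tn1.
Qed.

Lemma vertices_convex_position V :
  convex_position V -> vertices (convex_hull V) = V.
Proof.
move=> cV; apply/seteqP; split; first exact: vertices_sub.
move=> v Vv; split; first exact: sub_convex_hull.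
have hullE : convex_hull V `<=` [set x | exists r y,
    [/\ 0 <= r, r <= 1, r = 0 \/ convex_hull (V `\ v) y &
        x = v + r *: (y - v)]].
  apply: convex_hull_min; first exact/convex_cone/convex_convex_hull.
  move=> w Vw; have [->|wv] := eqVneq w v.
    by exists 0, v; rewrite lexx ler01 scale0r addr0; split=> //; left.
  exists 1, w; rewrite scale1r addrC subrK; split=> //; right.
  by apply: sub_convex_hull; split => //; exact/eqP.
move=> y z t Vy Vz t_gt0 t_lt1 vE.
have [r [y' [r0 r1 Cy yE]]] := hullE _ Vy.
have [s [z' [s0 s1 Cz zE]]] := hullE _ Vz.
have tr0 : 0 <= t * r by apply: mulr_ge0 => //; exact: ltW.
have ts0 : 0 <= (1 - t) * s by apply: mulr_ge0 => //; lra.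
have [/eqP|q0] := eqVneq (t * r + (1 - t) * s) 0.
  rewrite paddr_eq0// !mulf_eq0 (gt_eqF t_gt0) subr_eq0 (gt_eqF t_lt1) /=.
  by move=> /andP[/eqP r_0 /eqP s_0]; rewrite yE zE r_0 s_0 !scale0r !addr0.
(* Otherwise [v] would be a barycenter of [y'] and [z'], with weights
   proportional to [t * r] and [(1 - t) * s]. *)
exfalso; apply: (cV v Vv).
have q_gt0 : 0 < t * r + (1 - t) * s by rewrite lt_def q0 addr_ge0.
have vq : v = (t * r + (1 - t) * s)^-1 *:
    ((t * r) *: y' + ((1 - t) * s) *: z').
  move: vE; rewrite yE zE => /rowP e; apply/rowP => k.
  move: (e k); rewrite !mxE => ek; apply: (mulfI q0).
  by rewrite mulrA divff// mul1r; lra.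
rewrite [X in convex_hull _ X]vq.
apply: convex_set_barycenter => //; first exact: convex_convex_hull.
  by case: Cy => [->|]; [left; rewrite mulr0|right].
by case: Cz => [->|]; [left; rewrite mulr0|right].
Qed.

Lemma insertion_move_setD1 V v : convex_position V -> V v ->
  insertion_move (convex_hull (V `\ v)) (convex_hull V).
Proof.
move=> cV Vv; have hullE :
    convex_hull (convex_hull (V `\ v) `|` [set v]) = convex_hull V.
  by rewrite convex_hullU setUC setDUK// => _ ->.
exists v; last by rewrite hullE.
split; first exact: cV.
rewrite hullE !vertices_convex_position//; last exact: convex_positionS cV.
by rewrite setUC setDUK// => _ ->.
Qed.

(** Discarding one after the other the points that lie in the hull of the
    remaining ones does not change the hull. *)
Lemma polytope_convex_position P : polytope P ->
  exists V, [/\ finite_set V, convex_position V & P = convex_hull V].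
Proof.
move=> [A /finite_seqP[s ->] ->].
have [n] := ubnP (size s); elim: n s => // n IHn s sn.
have [cs|] := pselect (convex_position [set` s]).
  by exists [set` s]; split => //; exact: finite_seq.
move=> /existsNP[v /not_implyP[sv /contrapT hv]].
pose s' := [seq w <- s | w != v].
have s'E : [set` s'] = [set` s] `\ v.
  apply/seteqP; split=> w; rewrite /= mem_filter.
    by move=> /andP[/eqP].
  by move=> [ws /eqP wv]; rewrite wv.
have /IHn : (size s' < n)%N.
  rewrite -ltnS (leq_trans _ sn)// ltnS size_filter -(count_predC (pred1 v) s).
  by rewrite -add1n leq_add2r -has_count has_pred1.
rewrite s'E => -[V [fV cV e]]; exists V; split => //; rewrite -e.
apply/seteqP; split; last by apply: convex_hullS; exact: subDsetl.
apply: convex_hull_min; first exact: convex_convex_hull.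
move=> w ws; have [->//|wv] := eqVneq w v.
by apply: sub_convex_hull; split => //; exact/eqP.
Qed.

End ConvexHull.

(** * Affine hulls *)

Section AffineHull.
Variables (R : realType) (d : nat).
Local Notation E := ('rV[R]_d).
Implicit Types (A V : set E) (x y : E).

Definition spanning A := affine_hull A = setT.

Lemma affine_affine_hull A : affine_set (affine_hull A).
Proof.
move=> x y t Ax Ay C [cC AC].
by apply: (cC); [exact: (Ax C (conj cC AC))|exact: (Ay C (conj cC AC))].
Qed.

Lemma sub_affine_hull A : A `<=` affine_hull A.
Proof. exact: sub_gen_smallest. Qed.

Lemma affine_hull_min A C : affine_set C -> A `<=` C -> affine_hull A `<=` C.
Proof. exact: smallest_sub. Qed.

Lemma spanningS A V : A `<=` V -> spanning A -> spanning V.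
Proof.
move=> AV sA; rewrite /spanning -subTset -sA.
apply: affine_hull_min; first exact: affine_affine_hull.
exact: subset_trans AV (@sub_affine_hull V).
Qed.

Lemma spanning_convex_hull A : spanning (convex_hull A) <-> spanning A.
Proof.
split; last by apply: spanningS; exact: sub_convex_hull.
move=> sA; rewrite /spanning -subTset -sA.
apply: affine_hull_min; first exact: affine_affine_hull.
apply: convex_hull_min; last exact: sub_affine_hull.
by apply/convex_setP => x y t Ax Ay _ _; exact: affine_affine_hull.
Qed.

Lemma has_dim_spanning A : has_dim A d <-> spanning A.
Proof.
split=> [[x [U [AE Ud]]]|sA].
  have UT : U = fullv.
    apply/eqP; rewrite eqEdim subvf Ud dimvf /dim /=.
    by rewrite mul1n.
  rewrite /spanning AE UT -subTset => y _.
  by exists (y - x); [exact: memvf|rewrite addrC subrK].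
exists 0, fullv; split; last by rewrite dimvf /dim /= mul1n.
rewrite sA; apply/esym; rewrite -subTset => y _.
by exists y; [exact: memvf|rewrite add0r].
Qed.

(** Taking [x0] as origin turns an affine set into a linear subspace: it is
    stable under [z |-> z + a *: (x - x0)], the midpoint of
    [x0 + (2 * a) *: (x - x0)] and of the reflection of [x0] in [z]. *)
Lemma affine_setD A x0 x z (a : R) : affine_set A -> A x0 -> A x -> A z ->
  A (z + a *: (x - x0)).
Proof.
move=> cA A0 Ax Az.
have -> : z + a *: (x - x0) =
    2^-1 *: (2 * a *: x + (1 - 2 * a) *: x0) +
    (1 - 2^-1) *: (2 *: z + (1 - 2) *: x0).
  by apply/rowP => k; rewrite !mxE; field.
by do 2![apply: (cA) => //].
Qed.

Lemma affine_set_span A x0 (I : finType) (b : I -> E) (l : I -> R) :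
  affine_set A -> A x0 -> (forall j, A (b j)) ->
  A (x0 + \sum_j l j *: (b j - x0)).
Proof.
move=> cA A0 Ab.
elim: (index_enum _) => [|j s IHs]; first by rewrite big_nil addr0.
by rewrite big_cons addrCA addrC; exact: affine_setD.
Qed.

Lemma affine_set_sum A n (b : 'I_n -> E) (l : 'I_n -> R) : affine_set A ->
  (forall j, A (b j)) -> \sum_j l j = 1 -> A (\sum_j l j *: b j).
Proof.
case: n b l => [|n] b l cA Ab l1.
  by move: l1; rewrite big_ord0 => /esym/eqP; rewrite oner_eq0.
have -> : \sum_j l j *: b j = b ord0 + \sum_j l j *: (b j - b ord0).
  under [in RHS]eq_bigr do rewrite scalerBr.
  by rewrite sumrB -scaler_suml l1 scale1r addrC subrK.
exact: affine_set_span.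
Qed.

Lemma exists_spanning : exists2 V : set E, finite_set V & spanning V.
Proof.
exists ([set 0] `|` range (fun j : 'I_d => delta_mx 0 j)).
  rewrite finite_setU; split; first exact: finite_set1.
  exact/finite_image/finite_finset.
rewrite /spanning -subTset => x _; set V := _ `|` _.
have -> : x = 0 + \sum_j x 0 j *: (delta_mx 0 j - 0).
  by rewrite add0r [LHS]row_sum_delta; apply: eq_bigr => j _; rewrite subr0.
apply: affine_set_span; first exact: affine_affine_hull.
  by apply: sub_affine_hull; left.
by move=> j; apply: sub_affine_hull; right; exists j.
Qed.

End AffineHull.

(** * Affine bases and barycentric coordinates *)

Section Frames.
Variables (R : realType) (d : nat).
Local Notation E := ('rV[R]_d).
Implicit Types (A V : set E) (x y : E) (b : 'I_(1 + d) -> E).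

Definition homog m (X : 'M[R]_(m, d)) : 'M[R]_(m, 1 + d) :=
  row_mx (const_mx 1) X.

Lemma row_homog m (X : 'M[R]_(m, d)) i : row i (homog X) = homog (row i X).
Proof. by rewrite /homog row_row_mx row_const. Qed.

Definition affine_form (u : 'cV[R]_(1 + d)) x : R := (homog x *m u) 0 0.

Lemma homogD x y (t : R) :
  homog (t *: x + (1 - t) *: y) = t *: homog x + (1 - t) *: homog y.
Proof.
rewrite /homog !scale_row_mx add_row_mx; congr row_mx.
by apply/rowP => k; rewrite !mxE; ring.
Qed.

Lemma affine_formD u x y (t : R) :
  affine_form u (t *: x + (1 - t) *: y) =
  t * affine_form u x + (1 - t) * affine_form u y.
Proof. by rewrite /affine_form homogD mulmxDl -!scalemxAl !mxE. Qed.

Lemma homog_mul_eq0 n (K : 'M_(1 + d, n)) :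
  (forall x, homog x *m K = 0) -> K = 0.
Proof.
move=> K0; rewrite -[K]vsubmxK.
have e x : (const_mx 1 : 'M_1) *m usubmx K + x *m dsubmx K = 0.
  by rewrite -mul_row_col vsubmxK; exact: K0.
have u0 : (const_mx 1 : 'M_1) *m usubmx K = 0.
  by rewrite -(e 0) mul0mx addr0.
have -> : usubmx K = 0.
  by rewrite -[usubmx K]mul1mx -u0; congr (_ *m _); apply/matrixP => i j;
    rewrite !mxE !ord1 eqxx.
have -> : dsubmx K = 0.
  by apply/row_matrixP => i; rewrite rowE row0 -(e (delta_mx 0 i)) u0 add0r.
exact: col_mx0.
Qed.

(** Frames are the affine bases of the space. For a frame [b], the equation
    [homog x = l *m frame_mx b] says that [l] is the row of barycentric
    coordinates of [x]: it packs [x = \sum_j l 0 j *: b j] and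
    [\sum_j l 0 j = 1] together ([homog_frameP]). *)
Definition frame_mx b := homog (\matrix_j b j).

Definition frame b := frame_mx b \in unitmx.

Lemma row_frame_mx b j : row j (frame_mx b) = homog (b j).
Proof. by rewrite row_homog rowK. Qed.

Lemma homog_frameP b x (l : 'rV[R]_(1 + d)) : homog x = l *m frame_mx b <->
  \sum_j l 0 j = 1 /\ x = \sum_j l 0 j *: b j.
Proof.
rewrite /frame_mx /homog mul_mx_row; split.
  move=> /eq_row_mx[/rowP/(_ 0) l1 ->]; split.
    move: l1; rewrite !mxE => ->; apply: eq_bigr => j _.
    by rewrite mxE mulr1.
  by rewrite mulmx_sum_row; apply: eq_bigr => j _; rewrite rowK.
move=> [l1 ->]; congr row_mx; last first.
  by rewrite mulmx_sum_row; apply: eq_bigr => j _; rewrite rowK.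
apply/rowP => k; rewrite [LHS]mxE [RHS]mxE -[LHS]l1; apply: eq_bigr => j _.
by rewrite mxE mulr1.
Qed.

Lemma frame_coord b x : frame b ->
  homog x = (homog x *m invmx (frame_mx b)) *m frame_mx b.
Proof. by move=> fb; rewrite mulmxKV. Qed.

Lemma affine_form_coord b x (l : 'rV[R]_(1 + d)) u :
  homog x = l *m frame_mx b ->
  affine_form u x = \sum_j l 0 j * affine_form u (b j).
Proof.
move=> xl; rewrite /affine_form xl -mulmxA mxE; apply: eq_bigr => j _.
by rewrite -row_frame_mx -row_mul [in RHS]mxE.
Qed.

Lemma affine_interpolation b (a : 'I_(1 + d) -> R) : frame b ->
  exists u, forall j, affine_form u (b j) = a j.
Proof.
move=> fb; exists (invmx (frame_mx b) *m \col_j a j) => j.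
by rewrite /affine_form -row_frame_mx -row_mul mulKVmx// !mxE.
Qed.

Lemma frame_spanning b : frame b -> spanning (range b).
Proof.
move=> fb; rewrite /spanning -subTset => x _.
have /homog_frameP[l1 ->] := frame_coord x fb.
apply: affine_set_sum l1; first exact: affine_affine_hull.
by move=> j; apply: sub_affine_hull; exists j.
Qed.

(** If the homogeneous coordinates of the points of [V] had rank at most [d],
    all these points would lie on a hyperplane. *)
Lemma spanning_frame V : finite_set V -> spanning V ->
  exists2 b, frame b & range b `<=` V.
Proof.
move=> /finite_seqP[s ->] sV.
pose X := \matrix_(i < size s) nth 0 s i.
have fX : row_full (homog X).
  rewrite -sub1mx; apply: contraT; rewrite submxE mul1mx => /eqP[].
  set K := cokermx _.
  suff zero x : homog x *m K = 0 by rewrite [K](homog_mul_eq0 zero).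
  suff sub : affine_hull [set` s] `<=` [set z | homog z *m K = 0].
    by apply: sub; rewrite sV.
  apply: affine_hull_min => [y z t /= Ky Kz|y /= ys].
    by rewrite homogD mulmxDl -!scalemxAl Ky Kz !scaler0 addr0.
  rewrite -index_mem in ys; have -> : y = row (Ordinal ys) X.
    by rewrite rowK nth_index// -index_mem.
  by rewrite -row_homog -row_mul mulmx_coker row0.
exists (fun j => nth 0 s (fullrankfun fX j)); last first.
  by move=> _ [j _ <-]; exact: mem_nth.
have := fullrowsub_unit fX; rewrite /frame; congr (_ \in unitmx).
by apply/row_matrixP => j; rewrite row_frame_mx row_rowsub row_homog rowK.
Qed.

(** The half-space where an affine form is nonpositive is convex, so it contains
    the hull of the points of [V] it contains. *)
Lemma convex_position_sep V :
  (forall v, V v -> exists2 u, 0 < affine_form u v &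
    forall w, V w -> w <> v -> affine_form u w <= 0) -> convex_position V.
Proof.
move=> sep v Vv hv; have [u uv uw] := sep v Vv.
suff /(_ v hv) : convex_hull (V `\ v) `<=` [set x | affine_form u x <= 0].
  by rewrite /= leNgt uv.
apply: convex_hull_min; last by move=> w [Vw wv]; exact: uw.
by apply/convex_setP => x y t /= ux uy t0 t1; rewrite affine_formD; nra.
Qed.

Definition exchange b i y : 'I_(1 + d) -> E :=
  fun j => if j == i then y else b j.

Section Exchange.
Variables (b : 'I_(1 + d) -> E) (i : 'I_(1 + d)) (y : E) (l : 'rV[R]_(1 + d)).
Hypotheses (fb : frame b) (yl : homog y = l *m frame_mx b) (li : l 0 i != 0).

(** The rule is obtained by solving [homog y = l *m frame_mx b] for [b i]. *)
Lemma exchange_coord x (m : 'rV[R]_(1 + d)) : homog x = m *m frame_mx b ->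
  homog x = (\row_j if j == i then m 0 i / l 0 i
                    else m 0 j - m 0 i / l 0 i * l 0 j)
            *m frame_mx (exchange b i y).
Proof.
move=> xm; rewrite xm [RHS]mulmx_sum_row [LHS]mulmx_sum_row.
rewrite [LHS](bigD1 i)//= [RHS](bigD1 i)//=.
rewrite !row_frame_mx mxE /exchange eqxx.
have -> : homog y = l 0 i *: homog (b i)
    + \sum_(j | j != i) l 0 j *: row j (frame_mx b).
  by rewrite yl mulmx_sum_row (bigD1 i)//= row_frame_mx.
rewrite scalerDr scalerA divfK//.
rewrite -addrA; congr (_ + _); rewrite scaler_sumr -big_split/=.
apply: eq_bigr => j /negPf ji; rewrite mxE !row_frame_mx ji.
by rewrite scalerA -scalerDl addrC subrK.
Qed.

Lemma frame_exchange : frame (exchange b i y).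
Proof.
rewrite /frame -row_full_unit -sub1mx.
apply: (@submx_trans _ _ _ _ _ _ (frame_mx b)).
  by rewrite sub1mx row_full_unit.
apply/row_subP => j; rewrite row_frame_mx.
have /exchange_coord -> : homog (b j) = delta_mx 0 j *m frame_mx b.
  by rewrite -rowE row_frame_mx.
exact: submxMl.
Qed.

End Exchange.

End Frames.

(** * Paths between polytopes *)

Section Joined.
Variables (R : realType) (d : nat).
Local Notation E := ('rV[R]_d).
Implicit Types (V W : set E) (x y v : E) (b : 'I_(1 + d) -> E).

(** The endpoints of a path carry proofs that they are full-dimensional
    polytopes; generating sets are free of them and easier to compose. *)
Definition joined V W := exists P Q : full_polytope R d,
  [/\ sval P = convex_hull V, sval Q = convex_hull W &
      clos_refl_trans _ (@Gamma R d) P Q].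

Lemma exists_full_polytope V : finite_set V -> spanning V ->
  exists P : full_polytope R d, sval P = convex_hull V.
Proof.
move=> fV sV.
suff full : polytope (convex_hull V) /\ has_dim (convex_hull V) d.
  by exists (exist (fun P => polytope P /\ has_dim P d) _ full).
split; first by exists V.
exact/has_dim_spanning/spanning_convex_hull.
Qed.

Lemma joined_refl V : finite_set V -> spanning V -> joined V V.
Proof.
move=> fV /(exists_full_polytope fV)[P PV].
by exists P, P; split=> //; exact: rt_refl.
Qed.

Lemma joined_sym V W : joined V W -> joined W V.
Proof.
move=> [P [Q [PV QW PQ]]]; exists Q, P; split=> //.
elim: PQ => [{PV QW} {}P {}Q PQ|S|S T U _ TS _ UT].
- by apply: rt_step; case: PQ; [right|left].
- exact: rt_refl.
- exact: rt_trans UT TS.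
Qed.

Lemma full_polytope_inj (P Q : full_polytope R d) : sval P = sval Q -> P = Q.
Proof. by case: P Q => [P hP] [Q hQ] /= PQ; exact: eq_exist. Qed.

Lemma joined_trans W V U : joined V W -> joined W U -> joined V U.
Proof.
move=> [P [Q [PV QW PQ]]] [Q' [S [QW' SU QS]]]; exists P, S; split=> //.
by apply: rt_trans PQ _; rewrite (full_polytope_inj (etrans QW (esym QW'))).
Qed.

Lemma joined_setD1 V v : finite_set V -> convex_position V -> V v ->
  spanning (V `\ v) -> joined V (V `\ v).
Proof.
move=> fV cV Vv sV.
have [|P PV] := exists_full_polytope (finite_setD [set v] fV); first by [].
have [|Q QV] := @exists_full_polytope V fV; first exact: spanningS sV.
exists Q, P; split=> //; apply: rt_step; right; rewrite PV QV.
exact: insertion_move_setD1.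
Qed.

(** Every set between [W] and [V] is in convex position and spanning, so the
    points of [V] outside of [W] can be deleted one after the other. *)
Lemma joined_sub V W : finite_set V -> convex_position V -> W `<=` V ->
  spanning W -> joined V W.
Proof.
move=> fV cV WV sW; have /finite_seqP[s sE] := fV.
have : V = W `|` [set` s] by rewrite -sE setUidr.
have: [set` s] `<=` V by rewrite -sE.
elim: s V fV cV WV {sE} => [|v s IHs] V fV cV WV sV VE.
  move: VE; rewrite set_nil setU0 => ->; apply: joined_refl => //.
  exact: sub_finite_set fV.
have [Wv|Wv] := pselect ((W `|` [set` s]) v).
  apply: IHs => //; first by move=> w ws; apply: sV; rewrite /= inE ws orbT.
  rewrite VE; apply/seteqP; split=> w /=; rewrite inE; last first.
    by case=> [|ws]; [left|right; rewrite ws orbT].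
  by case=> [|/orP[/eqP->|]]; [left| exact: Wv|right].
have Vv : V v by apply: sV; rewrite /= mem_head.
have V'E : V `\ v = W `|` [set` s].
  rewrite VE; apply/seteqP; split=> w /=.
    by move=> [[|]]; [left|rewrite inE => /orP[/eqP|] //; right].
  move=> Ww; split; last by move=> wv; apply: Wv; rewrite -wv.
  by case: Ww => [|ws]; [left|right; rewrite inE ws orbT].
have WV' : W `<=` V `\ v by rewrite V'E; exact: subsetUl.
apply: (@joined_trans (V `\ v)).
  by apply: joined_setD1 => //; exact: spanningS sW.
apply: IHs => //; first exact: finite_setD.
- exact: convex_positionS cV.
- by rewrite V'E; exact: subsetUr.
Qed.

Lemma sum_delta n (f : 'I_n -> R) i : \sum_j f j * (j == i)%:R = f i.
Proof.
rewrite (bigD1 i)//= eqxx mulr1 big1 ?addr0// => j /negPf->.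
by rewrite mulr0.
Qed.

Lemma finite_range b : finite_set (range b).
Proof. exact/finite_image/finite_finset. Qed.

(** The coordinate of index [r] separates [x] from the frame. If [l j <= 0], the
    coordinate of index [j] separates [b j] from the other points. If [l j > 0],
    it has to be corrected by a negative multiple of another coordinate that is
    positive at [x], so as to vanish at [x]. *)
Lemma convex_position_frameU1 b x (l : 'rV[R]_(1 + d)) p q r :
  frame b -> homog x = l *m frame_mx b ->
  p != q -> 0 < l 0 p -> 0 < l 0 q -> l 0 r < 0 ->
  convex_position (range b `|` [set x]).
Proof.
move=> fb xl pq lp lq lr; apply: convex_position_sep.
move=> _ [[j _ <-]|->]; last first.
  have [u ub] := affine_interpolation (fun k => - (k == r)%:R) fb.
  have ux : affine_form u x = - l 0 r.
    rewrite (affine_form_coord u xl); under eq_bigr do rewrite ub mulrN.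
    by rewrite sumrN sum_delta.
  exists u; first by rewrite ux oppr_gt0.
  by move=> _ [[k _ <-] _|->//]; rewrite ub oppr_le0.
have [lj|lj] := lerP (l 0 j) 0.
  have [u ub] := affine_interpolation (fun k => (k == j)%:R) fb.
  exists u; first by rewrite ub eqxx.
  move=> _ [[k _ <-] kj|-> _].
    by rewrite ub; case: eqVneq kj => [->|].
  rewrite (affine_form_coord u xl); under eq_bigr do rewrite ub.
  by rewrite sum_delta.
have [j' j'j lj'] : exists2 j', j' != j & 0 < l 0 j'.
  by have [<-|] := eqVneq p j; [exists q; rewrite // eq_sym|exists p].
have [u ub] := affine_interpolation
  (fun k => (k == j)%:R - l 0 j / l 0 j' * (k == j')%:R) fb.
exists u; first by rewrite ub eqxx eq_sym (negPf j'j) mulr0 subr0.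
move=> _ [[k _ <-] kj|-> _].
  rewrite ub; case: eqVneq kj => [->//|_ _]; rewrite sub0r oppr_le0.
  by rewrite mulr_ge0// divr_ge0// ltW.
rewrite (affine_form_coord u xl); under eq_bigr do rewrite ub mulrBr mulrCA.
rewrite sumrB -mulr_sumr !sum_delta divfK ?subrr//.
exact: lt0r_neq0.
Qed.

Lemma convex_position_frame b : frame b -> convex_position (range b).
Proof.
move=> fb; apply: convex_position_sep => _ [j _ <-].
have [u ub] := affine_interpolation (fun k => (k == j)%:R) fb.
exists u; first by rewrite ub eqxx.
by move=> _ [k _ <-] kj; rewrite ub; case: eqVneq kj => [->|].
Qed.

Lemma joined_insert_delete b x (l : 'rV[R]_(1 + d)) i p q r :
  frame b -> homog x = l *m frame_mx b ->
  p != q -> 0 < l 0 p -> 0 < l 0 q -> l 0 r < 0 -> l 0 i != 0 ->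
  joined (range b) (range (exchange b i x)).
Proof.
move=> fb xl pq lp lq lr li.
have cV := convex_position_frameU1 fb xl pq lp lq lr.
have fV : finite_set (range b `|` [set x]).
  by rewrite finite_setU; split; [exact: finite_range|exact: finite_set1].
apply: (@joined_trans (range b `|` [set x])).
  by apply/joined_sym/joined_sub => //; exact: frame_spanning.
apply: joined_sub => //; last exact/frame_spanning/(frame_exchange fb xl).
move=> _ [j _ <-]; rewrite /exchange; case: eqP => _; first by right.
by left; exists j.
Qed.

Lemma exists_coord b i p q (s t : R) : p != i -> q != i -> p != q ->
  exists x (m : 'rV[R]_(1 + d)),
    [/\ homog x = m *m frame_mx b, m 0 i = s, m 0 p = t & m 0 q = 1 - s - t].
Proof.
move=> pi qi pq.
pose m : 'rV[R]_(1 + d) :=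
  \row_j (s * (j == i)%:R + t * (j == p)%:R + (1 - s - t) * (j == q)%:R).
exists (\sum_j m 0 j *: b j), m; split; last 1 first.
- by rewrite mxE (negPf qi) eq_sym (negPf pq) eqxx /=; ring.
- apply/homog_frameP; split=> //.
  have delta1 k : \sum_(j < 1 + d) (j == k)%:R = 1 :> R.
    rewrite -[RHS](sum_delta (fun=> 1) k).
    by under [RHS]eq_bigr do rewrite mul1r.
  under eq_bigr do rewrite mxE.
  by rewrite !big_split/= -!mulr_sumr !delta1; ring.
- by rewrite mxE eqxx eq_sym (negPf pi) eq_sym (negPf qi) /=; ring.
- by rewrite mxE (negPf pi) eqxx (negPf pq) /=; ring.
Qed.

Lemma exists_two_others (i : 'I_(1 + d)) : (2 <= d)%N ->
  exists p q, [/\ p != i, q != i & p != q].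
Proof.
move=> d2; have : (1 < #|predC1 i|)%N by rewrite cardC1 card_ord.
by move=> /card_gt1P[p [q [pi qi pq]]]; exists p, q.
Qed.

(** The intermediate point [x] has positive coordinates at [i] and [p] and a
    negative one at [q], with respect to both frames; the bound [M] makes the
    last two dominate those of [y]. *)
Lemma joined_exchange_pos b y (l : 'rV[R]_(1 + d)) i : (2 <= d)%N ->
  frame b -> homog y = l *m frame_mx b -> 0 < l 0 i ->
  joined (range b) (range (exchange b i y)).
Proof.
move=> d2 fb yl li; have [p [q [pi qi pq]]] := exists_two_others i d2.
have li0 : l 0 i != 0 by exact: lt0r_neq0.
pose M := 1 + `|l 0 p| + `|1 - l 0 i| + `|l 0 q|.
have [Mgt0 Mp Mq Mq'] : [/\ 0 < M, 0 < M - l 0 p, 1 - l 0 i - M < 0 &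
    1 - l 0 i - M - l 0 q < 0].
  have n1 := ler_norm (l 0 p); have n2 := ler_norm (1 - l 0 i).
  have n3 := ler_norm (- l 0 q); rewrite normrN in n3.
  have n4 := normr_ge0 (l 0 p); have n5 := normr_ge0 (1 - l 0 i).
  have n6 := normr_ge0 (l 0 q).
  by rewrite /M; split; lra.
have [x [m [xm mi mp mq]]] := exists_coord b (l 0 i) M pi qi pq.
apply: (@joined_trans (range (exchange b i x))).
  by apply: (joined_insert_delete (p := i) (q := p) (r := q) fb xm);
    rewrite ?mi ?mp ?mq// eq_sym.
have -> : exchange b i x = exchange (exchange b i y) i x.
  by apply/funext => j; rewrite /exchange; case: eqP.
apply/joined_sym.
by apply: (joined_insert_delete (p := i) (q := p) (r := q)
    (frame_exchange fb yl li0) (exchange_coord yl li0 xm));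
  rewrite ?mxE ?eqxx ?(negPf pi) ?(negPf qi) ?mi ?mp ?mq
    ?divff ?mul1r ?ltr01 ?oner_eq0// eq_sym.
Qed.

(** If [l i < 0], then [b i] and [y] are on opposite sides of the hyperplane
    spanned by the other points of the frame. Reflecting [b i] in the midpoint
    of [b p] and [b q] brings it to the side of [y]. *)
Lemma joined_exchange b y (l : 'rV[R]_(1 + d)) i : (2 <= d)%N ->
  frame b -> homog y = l *m frame_mx b -> l 0 i != 0 ->
  joined (range b) (range (exchange b i y)).
Proof.
move=> d2 fb yl; rewrite neq_lt => /orP[li|]; last exact: joined_exchange_pos.
have [p [q [pi qi pq]]] := exists_two_others i d2.
have [z [m [zm mi mp mq]]] := exists_coord b (-1) 1 pi qi pq.
have mq1 : m 0 q = 1 by rewrite mq opprK addrK.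
have mi0 : m 0 i != 0 by rewrite mi oppr_eq0 oner_eq0.
apply: (@joined_trans (range (exchange b i z))).
  by apply: (joined_insert_delete (p := p) (q := q) (r := i) fb zm) => //;
    rewrite ?mp ?mq1 ?mi ?ltr01 ?ltrN10.
have -> : exchange b i y = exchange (exchange b i z) i y.
  by apply/funext => j; rewrite /exchange; case: eqP.
apply: (joined_exchange_pos d2 (frame_exchange fb zm mi0)
  (exchange_coord zm mi0 yl)).
by rewrite mxE eqxx mi invrN invr1 mulrN1 oppr_gt0.
Qed.

(** Steinitz exchange: the points of [t] are brought one by one into a frame
    [c] that is initially [b]. As [t k] is not in the affine hull of the earlier
    points of [t], it has a nonzero coordinate at some [c i] that is none of
    them, and it can take its place. *)
Lemma joined_frames b t : (2 <= d)%N -> frame b -> frame t ->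
  joined (range b) (range t).
Proof.
move=> d2 fb ft.
suff /(_ (1 + d)%N (leqnn _)) [c [fc bc ct]] : forall k, (k <= 1 + d)%N ->
    exists c, [/\ frame c, joined (range b) (range c) &
      forall j : 'I_(1 + d), (j < k)%N -> range c (t j)].
  apply: joined_trans bc _; apply: joined_sub.
  - exact: finite_range.
  - exact: convex_position_frame.
  - by move=> _ [j _ <-]; exact: ct.
  - exact: frame_spanning.
elim=> [_|k IHk kd].
  by exists b; split=> //; apply: joined_refl;
    [exact: finite_range|exact: frame_spanning].
have [c [fc bc ct]] := IHk (ltnW kd).
pose k' := Ordinal kd.
have tk := frame_coord (t k') fc; set l := _ *m invmx _ in tk.
have [i [li it]] : exists i, l 0 i != 0 /\
    forall j : 'I_(1 + d), (j < k)%N -> t j != c i.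
  apply: contrapT => no.
  have [u ut] := affine_interpolation (fun j => (j == k')%:R) ft.
  have := ut k'; rewrite (affine_form_coord u tk) eqxx big1 => [/eqP|i _].
    by rewrite eq_sym oner_eq0.
  have [->|li] := eqVneq (l 0 i) 0; first by rewrite mul0r.
  have [j jk ji] : exists2 j : 'I_(1 + d), (j < k)%N & t j = c i.
    apply: contrapT => noj; apply: no; exists i; split=> // j jk.
    by apply/eqP => ji; apply: noj; exists j.
  rewrite -ji ut (_ : (j == k') = false) ?mulr0//.
  by apply/negbTE; rewrite -val_eqE/= neq_ltn jk.
exists (exchange c i (t k')); split; first exact: frame_exchange li.
  by apply: joined_trans bc _; exact: joined_exchange li.
move=> j; rewrite ltnS leq_eqVlt => /orP[/eqP jk|jk].
  by exists i; rewrite // /exchange eqxx; congr t; exact/val_inj.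
have [h _ hj] := ct j jk; exists h => //; rewrite /exchange.
by case: eqP => // hi; have := it j jk; rewrite -hj hi eqxx.
Qed.

End Joined.

Theorem corollary2p6 (R : realType) (d : nat) (hd : (2 <= d)%N) :
  graph_connected (@Gamma R d).
Proof.
split.
  have [V fV sV] := @exists_spanning R d.
  by have [P _] := exists_full_polytope fV sV; split.
have joined_frame (P : full_polytope R d) :
    exists V (b : 'I_(1 + d) -> 'rV[R]_d),
    [/\ sval P = convex_hull V, frame b & joined V (range b)].
  have [polP /has_dim_spanning sP] := svalP P.
  have [V [fV cV PV]] := polytope_convex_position polP.
  have sV : spanning V by apply/spanning_convex_hull; rewrite -PV.
  have [b fb bV] := spanning_frame fV sV.
  by exists V, b; split=> //; apply: joined_sub => //; exact: frame_spanning.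
move=> P Q; have [V [b [PV fb Vb]]] := joined_frame P.
have [W [c [QW fc Wc]]] := joined_frame Q.
have bc := joined_frames hd fb fc.
have [P' [Q' [P'V Q'W]]] := joined_trans (joined_trans Vb bc) (joined_sym Wc).
by rewrite (full_polytope_inj (etrans P'V (esym PV)))
  (full_polytope_inj (etrans Q'W (esym QW))).
Qed.
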